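(* Let $\mathfrak M$ be an intuitionistic structure, $I$ a set and $F$ an ultrafilter over $I$. Then the natural embedding of $\mathfrak M$ into the ultrapower $\mathfrak M^*=\prod_{i\in I}^F\mathfrak M$ is an elementary embedding.
   Context: **Language.** Fix a signature $(\mathrm{Cnst},\mathrm{Pred})$ of disjoint sets of constant symbols and predicate symbols (with arities), without function symbols, and a denumerable set $\mathrm{Var}$ of variables. Terms are elements of $\mathrm{Var}\cup\mathrm{Cnst}$. $\mathcal L$ is generated by $\varphi::=P(t_1,\dots,t_n)\mid\bot\mid\varphi\wedge\varphi\mid\varphi\vee\varphi\mid\varphi\to\varphi\mid\forall x\,\varphi\mid\exists x\,\varphi$ (no equality). **Intuitionistic structures.** An intuitionistic structure is $\mathfrak M=(W,\le,\{\mathfrak C_w\}_{w\in W})$ with $(W,\le)$ a poset and, for each $w$, $\mathfrak C_w=(D_w,I_w)$ a classical structure for a signature $(\mathrm{Cnst}_w,\mathrm{Pred})$ with $\mathrm{Cnst}_w\subseteq\mathrm{Cnst}$ ($D_w$ nonempty, $I_w(c)\in D_w$ for $c\in\mathrm{Cnst}_w$, $I_w(P)\subseteq D_w^n$ for $n$-ary $P$), such that (1) $w\le w'$ implies $D_w\subseteq D_{w'}$ and $I_w(P)\subseteq I_{w'}(P)$ for all $P$; (2) for each $c\in\mathrm{Cnst}$ there is $c^{\mathfrak M}\in\bigcup_wD_w$ such that for each $w$: if $c^{\mathfrak M}\in D_w$ then $c\in\mathrm{Cnst}_w$ and $I_w(c)=c^{\mathfrak M}$; otherwise $c\notin\mathrm{Cnst}_w$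 and $I_w(c)$ is undefined. Put $D_{\mathfrak M}=\bigcup_wD_w$. An assignment is a map $\rho:\mathrm{Var}\to D_{\mathfrak M}$, extended to $\rho^{\mathfrak M}$ on terms by $\rho^{\mathfrak M}(c)=c^{\mathfrak M}$; $\rho[x:=d]$ sends $x$ to $d$ and agrees with $\rho$ elsewhere. Satisfaction $\mathfrak M,w\Vdash^\rho\varphi$: $P(t_1,\dots,t_n)$ iff $(\rho^{\mathfrak M}(t_1),\dots,\rho^{\mathfrak M}(t_n))\in I_w(P)$; $\bot$ never; $\wedge,\vee$ pointwise at $w$; $\varphi\to\psi$ iff for all $w'\ge w$, $\mathfrak M,w'\Vdash^\rho\varphi$ implies $\mathfrak M,w'\Vdash^\rho\psi$; $\forall x\,\varphi$ iff for all $w'\ge w$ and $d\in D_{w'}$, $\mathfrak M,w'\Vdash^{\rho[x:=d]}\varphi$; $\exists x\,\varphi$ iff there is $d\in D_w$ with $\mathfrak M,w\Vdash^{\rho[x:=d]}\varphi$. **Filter product.** Let $\mathfrak M_i=(W_i,\le_i,\{(D_{i,w},I_{i,w})\}_{w\in W_i})$ for $i\in I$ and $F$ a filter on $I$. The filter product $\prod_{i\in I}^F\mathfrak M_i=(W,\le,\{(D_{\alpha_F},I_{\alpha_F})\}_{\alpha_F\in W})$ is defined as follows. $W$ is $\prod_{i\in I}W_i$ modulo $\alpha\sim\beta$ iff $\{i\mid\alpha(i)=\beta(i)\}\in F$, the class of $\alpha$ being $\alpha_F$. $\alpha_F\le\beta_F$ iff $\{i\mid\alpha(i)\le_i\beta(i)\}\in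 F$. With $D_i=\bigcup_{w\in W_i}D_{i,w}$, $D$ is $\prod_{i\in I}D_i$ modulo $\xi\approx\eta$ iff $\{i\mid\xi(i)=\eta(i)\}\in F$, with classes $\xi_F$, and $D_{\alpha_F}=\{\xi_F\in D\mid\{i\mid\xi(i)\in D_{i,\alpha(i)}\}\in F\}$. For $c\in\mathrm{Cnst}$ let $\tilde c(i)=c^{\mathfrak M_i}$; $I_{\alpha_F}(c)=\tilde c_F$ if $\tilde c_F\in D_{\alpha_F}$, and undefined otherwise. For $n$-ary $P$, $(\xi^1_F,\dots,\xi^n_F)\in I_{\alpha_F}(P)$ iff $\{i\mid(\xi^1(i),\dots,\xi^n(i))\in I_{i,\alpha(i)}(P)\}\in F$. (This is a well-defined intuitionistic structure with constants interpreted as $\tilde c_F$ and domain $D$.) If $F$ is an ultrafilter and all $\mathfrak M_i=\mathfrak M$, it is called an ultrapower of $\mathfrak M$, denoted $\mathfrak M^*$ with set of worlds $W^*$. **Natural embedding.** For $w\in W$ let $w^*\in W^*$ be the class of the constant function $i\mapsto w$, and for $d\in D_{\mathfrak M}$ let $d^*\in D_{\mathfrak M^*}$ be the class of the constant function $i\mapsto d$. The natural embedding is the pair $\epsilon:W\to W^*,\ w\mapsto w^*$ and $\eta:D_{\mathfrak M}\to D_{\mathfrak M^*},\ d\mapsto d^*$. **Elementary embedding.** An elementary embedding of $\mathfrak M$ into $\mathfrak M'$ is a pair $(\epsilon,\eta)$ of injective functions $\epsilon:W\to W'$ and $\eta:D_{\mathfrak M}\to D_{\mathfrak M'}$ such that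 for every $\varphi\in\mathcal L$, $w\in W$ and assignment $\rho$ for $\mathfrak M$: $\mathfrak M,w\Vdash^\rho\varphi$ iff $\mathfrak M',\epsilon(w)\Vdash^{\eta\circ\rho}\varphi$. *)

(* Defs.v *)
From HB Require Import structures.
From mathcomp Require Import all_boot.
From mathcomp Require Import boolp classical_sets functions cardinality filter.

Set Implicit Arguments.
Unset Strict Implicit.
Unset Printing Implicit Defensive.

Local Open Scope classical_set_scope.
Local Open Scope card_scope.
Local Open Scope quotient_scope.

Record language := Language {
  var : eqType;
  var_denumerable : [set: var] #= [set: nat];
  cnst : Type;
  pred_sym : Type;
  arity : pred_sym -> nat
}.

Inductive term (L : language) :=
  | Var of var L
  | Cnst of cnst L.

Inductive formula (L : language) :=
  | Atom (P : pred_sym L) of (arity P).-tuple (term L)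
  | Bot
  | And of formula L & formula L
  | Or of formula L & formula L
  | Imp of formula L & formula L
  | All of var L & formula L
  | Ex of var L & formula L.

Arguments Bot {L}.

(* A classical structure whose domain is a subset of [U], for the signature
   whose constants are those [c] with [cst c <> None]: [cst] is the partial map
   c |-> I(c). *)
Record classical_structure (L : language) (U : Type) := ClassicalStructure {
  dom : set U;
  cst : cnst L -> option U;
  prd : forall P : pred_sym L, set ((arity P).-tuple U);
  dom_nonempty : dom !=set0;
  cst_dom : forall c d, cst c = Some d -> dom d;
  prd_dom : forall P t, @prd P t -> forall j, dom (tnth t j)
}.

(* [object] is D_M, the union of the local domains (field [object_cover]), and
   [cval c] is the global value c^M of the constant [c]. *)
Record istructure (L : language) := IStructure {
  world : Type;
  le : world -> world -> Prop;
  object : Type;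
  at_world : world -> classical_structure L object;
  cval : cnst L -> object;
  le_order : Relation_Definitions.order world le;
  object_cover : forall d, exists w, dom (at_world w) d;
  dom_mono : forall w w', le w w' ->
    dom (at_world w) `<=` dom (at_world w');
  prd_mono : forall w w', le w w' ->
    forall P, prd (at_world w) (P := P) `<=` prd (at_world w') (P := P);
  cst_defined : forall w c,
    dom (at_world w) (cval c) -> cst (at_world w) c = Some (cval c);
  cst_undefined : forall w c,
    ~ dom (at_world w) (cval c) -> cst (at_world w) c = None
}.

Definition assignment (L : language) (M : istructure L) := var L -> object M.

Definition update (L : language) (M : istructure L) (rho : assignment M)
    (x : var L) (d : object M) : assignment M :=
  fun y => if y == x then d else rho y.

Definition eval_term (L : language) (M : istructure L) (rho : assignment M)
    (t : term L) : object M :=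
  match t with
  | Var x => rho x
  | Cnst c => cval M c
  end.

Fixpoint sat (L : language) (M : istructure L) (w : world M)
    (rho : assignment M) (phi : formula L) : Prop :=
  match phi with
  | Atom P ts => prd (at_world w) (map_tuple (eval_term rho) ts)
  | Bot => False
  | And phi psi => sat w rho phi /\ sat w rho psi
  | Or phi psi => sat w rho phi \/ sat w rho psi
  | Imp phi psi => forall w', le w w' -> sat w' rho phi -> sat w' rho psi
  | All x phi => forall w', le w w' ->
      forall d, dom (at_world w') d -> sat w' (update rho x d) phi
  | Ex x phi => exists2 d, dom (at_world w) d & sat w (update rho x d) phi
  end.

Definition elementary_embedding (L : language) (M M' : istructure L)
    (eps : world M -> world M') (eta : object M -> object M') : Prop :=
  [/\ injective eps, injective eta
    & forall (phi : formula L) (w : world M) (rho : assignment M),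
        sat w rho phi <-> sat (eps w) (eta \o rho) phi].

Section ReducedProduct.
Variables (I : Type) (F : set_system I) (FF : Filter F) (T : I -> Type).

(* [{classic _}] only equips the product with the choice structure that
   [{eq_quot _}] requires; it is convertible to [forall i, T i]. *)
Definition feq (a b : {classic forall i, T i}) : bool :=
  `[< F [set i | a i = b i] >].

Lemma feq_refl : reflexive feq.
Proof. by move=> a; apply/asboolP; apply: filterE. Qed.

Lemma feq_sym : symmetric feq.
Proof.
by move=> a b; apply: asbool_equiv_eq; split; apply: filterS => i /= ->.
Qed.

Lemma feq_trans : transitive feq.
Proof.
move=> b a c /asboolP ab /asboolP bc; apply/asboolP.
by apply: filterS2 ab bc => i /= -> ->.
Qed.

Canonical feq_equiv := EquivRel feq feq_refl feq_sym feq_trans.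

Definition reduced_product : Type := {eq_quot feq_equiv}.

Definition rclass (a : forall i, T i) : reduced_product :=
  \pi_({eq_quot feq_equiv}) (a : {classic forall i, T i}).

Definition rrepr (x : reduced_product) : forall i, T i :=
  repr (x : {eq_quot feq_equiv}).

Lemma rreprK : cancel rrepr rclass.
Proof. by move=> x; apply: reprK. Qed.

Lemma rclassP a b : rclass a = rclass b <-> F [set i | a i = b i].
Proof.
split=> [/(@eqmodP _ feq_equiv)/asboolP //|ab].
by apply/(@eqmodP _ feq_equiv)/asboolP.
Qed.

Lemma rrepr_rclass a : F [set i | rrepr (rclass a) i = a i].
Proof. by apply/rclassP; rewrite rreprK. Qed.

End ReducedProduct.

Section FilterProduct.
Variables (L : language) (I : Type) (F : set_system I) (FF : Filter F).
Variable M : I -> istructure L.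

Definition fp_world := reduced_product FF (fun i => world (M i)).
Definition fp_object := reduced_product FF (fun i => object (M i)).

(* The relations below are defined on canonical representatives; the lemmas
   [fp_leE], [fp_domE] and [fp_prdE] state that any representatives will do. *)
Definition fp_le (x y : fp_world) : Prop :=
  F [set i | le (rrepr x i) (rrepr y i)].

Definition fp_dom (x : fp_world) : set fp_object :=
  [set d | F [set i | dom (at_world (rrepr x i)) (rrepr d i)]].

Definition fp_cval (c : cnst L) : fp_object :=
  rclass FF (fun i => cval (M i) c).

Definition fp_cst (x : fp_world) (c : cnst L) : option fp_object :=
  if `[< fp_dom x (fp_cval c) >] then Some (fp_cval c) else None.

Definition fp_prd (x : fp_world) (P : pred_sym L) :
    set ((arity P).-tuple fp_object) :=
  [set t | F [set i |
    prd (at_world (rrepr x i)) (map_tuple (fun d => rrepr d i) t)]].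

Lemma fp_leE a b :
  fp_le (rclass FF a) (rclass FF b) <-> F [set i | le (a i) (b i)].
Proof.
have ra := rrepr_rclass FF a; have rb := rrepr_rclass FF b.
by split; apply: filterS3 ra rb => i /= -> ->.
Qed.

Lemma fp_domE a d :
  fp_dom (rclass FF a) (rclass FF d) <->
  F [set i | dom (at_world (a i)) (d i)].
Proof.
have ra := rrepr_rclass FF a; have rd := rrepr_rclass FF d.
by split; apply: filterS3 ra rd => i /= -> ->.
Qed.

Lemma fp_prdE a P (t : (arity P).-tuple (forall i, object (M i))) :
  fp_prd (rclass FF a) (map_tuple (rclass FF (T := _)) t) <->
  F [set i | prd (at_world (a i)) (map_tuple (fun d => d i) t)].
Proof.
have ra := rrepr_rclass FF a.
have rt : F [set i | map_tuple (fun d => rrepr d i)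
    (map_tuple (rclass FF (T := _)) t) = map_tuple (fun d => d i) t].
  have := filter_forall FF (fun j => rrepr_rclass FF (tnth t j)).
  apply: filterS => i /= eq_t; apply: eq_from_tnth => j.
  by rewrite !tnth_map.
by split; apply: filterS3 ra rt => i /= -> ->.
Qed.

Lemma fp_dom_nonempty x : fp_dom x !=set0.
Proof.
pose d i := projT1 (cid (dom_nonempty (at_world (rrepr x i)))).
have domd i : dom (at_world (rrepr x i)) (d i).
  exact: projT2 (cid (dom_nonempty (at_world (rrepr x i)))).
by exists (rclass FF d); rewrite -[x]rreprK; apply/fp_domE; apply: filterE.
Qed.

Lemma fp_cst_dom x c d : fp_cst x c = Some d -> fp_dom x d.
Proof. by rewrite /fp_cst; case: asboolP => // domc [<-]. Qed.

Lemma fp_prd_dom x P (t : (arity P).-tuple fp_object) :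
  fp_prd x t -> forall j, fp_dom x (tnth t j).
Proof.
move=> xt j; apply: filterS xt => i /= /prd_dom/(_ j).
by rewrite tnth_map.
Qed.

Definition fp_at_world (x : fp_world) : classical_structure L fp_object :=
  {| dom_nonempty := fp_dom_nonempty x;
     cst_dom := @fp_cst_dom x;
     prd_dom := @fp_prd_dom x |}.

Lemma fp_le_order : Relation_Definitions.order fp_world fp_le.
Proof.
have leo i := le_order (M i).
split=> [x|x y z xy yz|x y xy yx].
- by apply: filterE => i; have [+ _ _] := leo i; apply.
- by apply: filterS2 xy yz => i; have [_ + _] := leo i; apply.
- rewrite -[x]rreprK -[y]rreprK; apply/rclassP.
  by apply: filterS2 xy yx => i; have [_ _ +] := leo i; apply.
Qed.

Lemma fp_object_cover d : exists x, fp_dom x d.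
Proof.
pose a i := projT1 (cid (object_cover (rrepr d i))).
have doma i : dom (at_world (a i)) (rrepr d i).
  exact: projT2 (cid (object_cover (rrepr d i))).
by exists (rclass FF a); rewrite -[d]rreprK; apply/fp_domE; apply: filterE.
Qed.

Lemma fp_dom_mono x y : fp_le x y -> fp_dom x `<=` fp_dom y.
Proof. by move=> xy d; apply: filterS2 xy => i /dom_mono; apply. Qed.

Lemma fp_prd_mono x y : fp_le x y ->
  forall P, fp_prd x (P := P) `<=` fp_prd y (P := P).
Proof. by move=> xy P t; apply: filterS2 xy => i /prd_mono; apply. Qed.

Lemma fp_cst_defined x c :
  fp_dom x (fp_cval c) -> fp_cst x c = Some (fp_cval c).
Proof. by rewrite /fp_cst; case: asboolP. Qed.

Lemma fp_cst_undefined x c : ~ fp_dom x (fp_cval c) -> fp_cst x c = None.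
Proof. by rewrite /fp_cst; case: asboolP. Qed.

Definition filter_product : istructure L :=
  {| at_world := fp_at_world;
     le_order := fp_le_order;
     object_cover := fp_object_cover;
     dom_mono := fp_dom_mono;
     prd_mono := fp_prd_mono;
     cst_defined := fp_cst_defined;
     cst_undefined := fp_cst_undefined |}.

End FilterProduct.

Section Ultrapower.
Variables (L : language) (M : istructure L).
Variables (I : Type) (F : set_system I) (FU : UltraFilter F).

Let FF : Filter F := @filter_filter _ _ (@ultra_proper _ _ FU).

Definition ultrapower : istructure L := filter_product FF (fun=> M).

Definition natural_world (w : world M) : world ultrapower :=
  rclass FF (fun=> w).

Definition natural_object (d : object M) : object ultrapower :=
  rclass FF (fun=> d).

End Ultrapower.

Arguments natural_world {L} M {I F} FU w.
Arguments natural_object {L} M {I F} FU d.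

(* Main.v *)
Require Import Defs.
From mathcomp Require Import all_boot.
From mathcomp Require Import boolp classical_sets functions cardinality filter.

(** The natural embedding is elementary because of an intuitionistic form of
    Łoś's theorem, [sat_filter_product]: in a product modulo an ultrafilter
    [F], a formula holds at the class of [a] under the classes of [r] exactly
    when it holds at [a i] under [r _ i] for [F]-almost every [i].  When all
    factors equal [M] and both [a] and [r] are constant in [i], the set of these
    [i] is everything or empty, and properness of [F] gives the claim.

    The theorem holds because for almost every [i] commutes with all the
    constructions in the clauses of satisfaction.  Conjunction needs only a
    filter, disjunction and implication need an ultrafilter
    ([ultra_or], [ultra_imp]), and quantification over a product of nonempty
    types commutes with any filter, by choosing a witness or a counterexample at
    each index ([filter_forall_prod], [filter_exists_prod]).  The Kripke clauses
    for implication and the universal quantifier bring in quantification over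
    worlds above the present one; as the order and the local domains of the
    product are themselves defined almost everywhere, these bounded
    quantifications are covered too. *)

Set Implicit Arguments.
Unset Strict Implicit.
Unset Printing Implicit Defensive.

Local Open Scope classical_set_scope.

Lemma pointwise_witness (I : Type) (T : I -> Type) (t0 : forall i, T i)
    (P : forall i, T i -> Prop) :
  exists t : forall i, T i, forall i, (exists u, P i u) -> P i (t i).
Proof.
have /all_sig[t tP] i : {u | (exists v, P i v) -> P i u}.
  have [/cid[u Pu]|nP] := pselect (exists v, P i v); first by exists u.
  by exists (t0 i).
by exists t.
Qed.

(** A pointwise counterexample [t] turns the single instance at [t] into the
    universal statement. *)
Lemma filter_forall_prod (I : Type) (F : set_system I) (FF : Filter F)
    (T : I -> Type) (t0 : forall i, T i) (P : forall i, T i -> Prop) :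
  (forall t : forall i, T i, F [set i | P i (t i)]) <->
  F [set i | forall u, P i u].
Proof.
split=> [FP|FP t]; last by apply: filterS FP => i /=; apply.
have [t tP] := pointwise_witness t0 (fun i u => ~ P i u).
apply: filterS (FP t) => i /= Pt u.
by apply: contrapT => nPu; apply: (tP i) => //; exists u.
Qed.

Lemma filter_exists_prod (I : Type) (F : set_system I) (FF : Filter F)
    (T : I -> Type) (t0 : forall i, T i) (P : forall i, T i -> Prop) :
  (exists t : forall i, T i, F [set i | P i (t i)]) <->
  F [set i | exists u, P i u].
Proof.
split=> [[t]|FP]; first by apply: filterS => i /= Pt; exists (t i).
have [t tP] := pointwise_witness t0 P.
by exists t; apply: filterS FP => i /tP.
Qed.

Lemma filter_and (I : Type) (F : set_system I) (FF : Filter F)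
    (A B : I -> Prop) :
  F [set i | A i] /\ F [set i | B i] <-> F [set i | A i /\ B i].
Proof.
split=> [[FA FB]|FAB]; first by apply: filterS2 FA FB.
by split; apply: filterS FAB => i [].
Qed.

Lemma ultra_imp (I : Type) (F : set_system I) (FU : UltraFilter F)
    (A B : I -> Prop) :
  (F [set i | A i] -> F [set i | B i]) <-> F [set i | A i -> B i].
Proof.
split=> [FAB|FAB FA]; last by apply: filterS2 FAB FA => i /=; apply.
have [/FAB|] := in_ultra_setVsetC [set i | A i] FU.
  by apply: filterS => i /=.
by apply: filterS => i /= nA /nA.
Qed.

Lemma ultra_or (I : Type) (F : set_system I) (FU : UltraFilter F)
    (A B : I -> Prop) :
  F [set i | A i] \/ F [set i | B i] <-> F [set i | A i \/ B i].
Proof.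
split=> [[]|FAB]; try by apply: filterS => i /=; tauto.
have [FA|FnA] := in_ultra_setVsetC [set i | A i] FU; first by left.
by right; apply: filterS2 FAB FnA => i /= [].
Qed.

Lemma filter_constP (I : Type) (F : set_system I) (FF : ProperFilter F)
    (P : Prop) :
  F [set _ | P] <-> P.
Proof. by split=> [/filter_ex[]//|p]; apply: filterE. Qed.

Lemma forall_iff (T : Type) (P Q : T -> Prop) :
  (forall x, P x <-> Q x) -> (forall x, P x) <-> (forall x, Q x).
Proof. by move=> PQ; split=> H x; apply/PQ. Qed.

Lemma exists_iff (T : Type) (P Q : T -> Prop) :
  (forall x, P x <-> Q x) -> (exists x, P x) <-> (exists x, Q x).
Proof. by move=> PQ; split=> -[x /PQ]; exists x. Qed.

Lemma imp_iff_r (A B C : Prop) : (B <-> C) -> (A -> B) <-> (A -> C).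
Proof. tauto. Qed.

Lemma forall_rclass (I : Type) (F : set_system I) (FF : Filter F)
    (T : I -> Type) (Q : reduced_product FF T -> Prop) :
  (forall x, Q x) <-> forall a, Q (rclass FF a).
Proof. by split=> [Qx a|Qa x] //; rewrite -[x]rreprK. Qed.

Lemma exists_rclass (I : Type) (F : set_system I) (FF : Filter F)
    (T : I -> Type) (Q : reduced_product FF T -> Prop) :
  (exists x, Q x) <-> exists a, Q (rclass FF a).
Proof.
split=> [[x]|[a Qa]]; last by exists (rclass FF a).
by rewrite -[x]rreprK; exists (rrepr x).
Qed.

(** A family of assignments, one for each factor, with values regrouped by
    variable, as an assignment for the product.  Every assignment for the
    product has this form, which survives updates ([update_fp_assignment]). *)
Definition fp_assignment (L : language) (I : Type) (F : set_system I)
    (FF : Filter F) (M : I -> istructure L)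
    (r : var L -> forall i, object (M i)) :
    assignment (filter_product FF M) :=
  fun x => rclass FF (r x).

Definition update_family (L : language) (I : Type) (M : I -> istructure L)
    (r : var L -> forall i, object (M i)) (x : var L)
    (d : forall i, object (M i)) : var L -> forall i, object (M i) :=
  fun y => if y == x then d else r y.

Lemma update_fp_assignment (L : language) (I : Type) (F : set_system I)
    (FF : Filter F) (M : I -> istructure L)
    (r : var L -> forall i, object (M i)) x d :
  update (fp_assignment FF r) x (rclass FF d) =
  fp_assignment FF (update_family r x d).
Proof.
by apply/funext => y; rewrite /update /fp_assignment /update_family; case: eqP.
Qed.

Lemma update_family_at (L : language) (I : Type) (M : I -> istructure L)
    (r : var L -> forall i, object (M i)) x d i :
  (update_family r x d)^~ i = update (r^~ i) x (d i) :> assignment (M i).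
Proof. by apply/funext => y; rewrite /update /update_family; case: eqP. Qed.

Lemma map_eval_fp_assignment (L : language) (I : Type) (F : set_system I)
    (FF : Filter F) (M : I -> istructure L)
    (r : var L -> forall i, object (M i)) n (ts : n.-tuple (term L)) :
  map_tuple (eval_term (fp_assignment FF r)) ts =
  map_tuple (rclass FF (T := _))
    (map_tuple (fun t i => eval_term (M := M i) (r^~ i) t) ts).
Proof. by apply: eq_from_tnth => j; rewrite !tnth_map; case: (tnth ts j). Qed.

(** Łoś's theorem.  The induction is on [phi] with [a] and [r] arbitrary, as the
    clauses for implication and [All] move to other worlds and those for the
    quantifiers update the assignment.  In each case both sides are rewritten
    to the same statement: quantifiers over the product become quantifiers over
    families, and for almost every [i] is then moved inwards to the atomic
    parts. *)
Lemma sat_filter_product (L : language) (I : Type) (F : set_system I)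
    (FF : Filter F) (FU : UltraFilter F) (M : I -> istructure L)
    (phi : formula L) (a : forall i, world (M i))
    (r : var L -> forall i, object (M i)) :
  sat (M := filter_product FF M) (rclass FF a) (fp_assignment FF r) phi <->
  F [set i | sat (a i) (r^~ i) phi].
Proof.
(* Default objects for the pointwise choices; local domains are nonempty. *)
have d0 i : object (M i) := projT1 (cid (dom_nonempty (at_world (a i)))).
elim: phi a r => [P ts||f IHf g IHg|f IHf g IHg|f IHf g IHg|x f IHf|x f IHf] a r.
- rewrite /= map_eval_fp_assignment; apply: iff_trans (fp_prdE _ _ _) _.
  by split; apply: filterS => i /=; congr (prd _ _); apply: eq_from_tnth => j;
     rewrite !tnth_map.
- by rewrite filter_constP.
- by rewrite /= IHf IHg filter_and.
- by rewrite /= IHf IHg ultra_or.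
- rewrite /= forall_rclass -(filter_forall_prod FF a); apply: forall_iff => b.
  by rewrite fp_leE IHf IHg !ultra_imp.
- rewrite /= forall_rclass -(filter_forall_prod FF a); apply: forall_iff => b.
  (* The premise [le (a i) (b i)] does not depend on the object [d], so it is
     split off before [d] is chosen pointwise. *)
  rewrite -ultra_imp fp_leE; apply: imp_iff_r.
  rewrite forall_rclass -(filter_forall_prod FF d0); apply: forall_iff => d.
  rewrite update_fp_assignment fp_domE IHf ultra_imp.
  by under eq_set do rewrite update_family_at.
- rewrite /= exists2E exists_rclass.
  under eq_set do rewrite exists2E.
  rewrite -(filter_exists_prod FF d0); apply: exists_iff => d.
  rewrite update_fp_assignment fp_domE IHf filter_and.
  by under eq_set do rewrite update_family_at.
Qed.

Theorem proposition5p8 (L : language) (M : istructure L) (I : Type)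
    (F : set_system I) (FU : UltraFilter F) :
  elementary_embedding (natural_world M FU) (natural_object M FU).
Proof.
split=> [w w' /rclassP/filter_constP//|d d' /rclassP/filter_constP//|f w rho].
apply: iff_sym; apply: iff_trans (sat_filter_product _ _ _ _ (fun y _ => rho y)) _.
exact: filter_constP.
Qed.
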